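(* Let $(H_n)_{n\in\mathbb{N}}$ be a countable collection of perfect groups. Then the abelianization $\mathrm{Ab}\big(\prod_{n\in\mathbb{N}}H_n\big)$ is a cotorsion group of Ulm length that does not exceed $\aleph_1$.
   Context: For a group $G$, $\mathrm{Ab}(G)=G/\mathrm{C}(G)$, where $\mathrm{C}(G)$ is the commutator subgroup. A group $G$ is perfect if $\mathrm{Ab}(G)=0$. An abelian group $A$ is cotorsion if $\mathrm{Ext}(\mathbb{Q},A)=0$, i.e. for every abelian group $B$ containing $A$ as a subgroup with $B/A\cong\mathbb{Q}$, $A$ is a direct summand of $B$. Ulm length: for an abelian group $A$ define subgroups $A^\lambda$ by transfinite recursion on ordinals: $A^0=A$; $A^{\lambda+1}=\bigcap_{n=1}^\infty nA^\lambda$, where $nB=\{nb: b\in B\}$; $A^\delta=\bigcap_{\lambda<\delta}A^\lambda$ for limit ordinals $\delta$. The Ulm length $u(A)$ is the smallest ordinal $\lambda$ with $A^{\lambda+1}=A^\lambda$. The cardinal $\aleph_1$ is regarded as an ordinal (the first uncountable ordinal). *)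

(* Defs.v *)
From HB Require Import structures.
From mathcomp Require Import all_boot all_order all_algebra.
From mathcomp Require Import boolp classical_sets functions cardinality.
From mathcomp Require Import wochoice.

Set Implicit Arguments.
Unset Strict Implicit.
Unset Printing Implicit Defensive.

Import GRing.Theory.

Section Commutator.
Variable G : groupType.
Local Open Scope group_scope.
Local Open Scope quotient_scope.

(* The subgroup generated by the commutators: the intersection of all the     *)
(* subgroups that contain them.                                               *)
Definition commutator_subgroup : {pred G} := fun x =>
  `[< forall S : {pred G},
        group_closed S -> (forall a b, [~ a, b] \in S) -> x \in S >].

Local Notation C := commutator_subgroup.

Lemma commutator_subgroupP x :
  reflect (forall S : {pred G},
             group_closed S -> (forall a b, [~ a, b] \in S) -> x \in S)
          (x \in C).
Proof. exact: asboolP. Qed.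

Lemma commg_commutator_subgroup a b : [~ a, b] \in C.
Proof. by apply/commutator_subgroupP => S _; apply. Qed.

Lemma commutator_subgroup_closed : group_closed C.
Proof.
split; first by apply/commutator_subgroupP => S [].
move=> x y /commutator_subgroupP xC /commutator_subgroupP yC.
apply/commutator_subgroupP => S Sg Sc; case: (Sg) => _; apply.
  exact: xC.
exact: yC.
Qed.

Let C1 : 1 \in C. Proof. by case: commutator_subgroup_closed. Qed.
Let CM x y : x \in C -> y \in C -> x * y \in C.
Proof. exact: (group_closedM commutator_subgroup_closed). Qed.
Let CV x : x \in C -> x^-1 \in C.
Proof. exact: (group_closedV commutator_subgroup_closed). Qed.

Lemma commutator_subgroup_normal x y : x \in C -> x ^ y \in C.
Proof.
move=> xC; have -> : x ^ y = x * [~ x, y] by rewrite commgEl mulVKg.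
by rewrite CM ?commg_commutator_subgroup.
Qed.

Definition ab_rel : rel G := fun x y => x^-1 * y \in C.

Lemma ab_rel_equiv : equiv_class_of ab_rel.
Proof.
split=> [x|x y|y x z]; rewrite /ab_rel; first by rewrite mulVg C1.
  by apply/idP/idP => /CV; rewrite invgM invgK.
by move=> xy yz; have := CM xy yz; rewrite mulgA mulgK.
Qed.

Canonical ab_rel_equivRel := EquivRelPack ab_rel_equiv.
Canonical ab_rel_encModRel := defaultEncModRel ab_rel.

Definition Ab := {eq_quot ab_rel}.

HB.instance Definition _ : EqQuotient G ab_rel Ab := EqQuotient.on Ab.
HB.instance Definition _ := Choice.on Ab.

Lemma ab_eqP x y : reflect (\pi_Ab x = \pi_Ab y) (x^-1 * y \in C).
Proof. by rewrite -[_ \in C]/(ab_rel x y) -eqmodE; exact: eqP. Qed.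

Definition ab_zero : Ab := \pi_Ab 1.
Definition ab_opp (u : Ab) : Ab := \pi_Ab (repr u)^-1.
Definition ab_add (u v : Ab) : Ab := \pi_Ab (repr u * repr v).

Lemma ab_addE x y : ab_add (\pi_Ab x) (\pi_Ab y) = \pi_Ab (x * y).
Proof.
rewrite /ab_add; case: piP => x' /ab_eqP xx'; case: piP => y' /ab_eqP yy'.
apply/ab_eqP; have := CV (CM yy' (commutator_subgroup_normal y' xx')).
by rewrite /conjg !invgM !invgK !mulgA mulgK.
Qed.

Lemma ab_oppE x : ab_opp (\pi_Ab x) = \pi_Ab x^-1.
Proof.
rewrite /ab_opp; case: piP => x' /ab_eqP xx'; apply/ab_eqP; rewrite invgK.
have := commutator_subgroup_normal x^-1 xx'.
by rewrite /conjg invgK !mulgA mulgV mul1g.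
Qed.

Lemma ab_addA : associative ab_add.
Proof.
elim/quotW=> x; elim/quotW=> y; elim/quotW=> z.
rewrite (ab_addE y z) (ab_addE x (y * z)) (ab_addE x y) (ab_addE (x * y) z).
by rewrite mulgA.
Qed.

Lemma ab_addC : commutative ab_add.
Proof.
elim/quotW=> x; elim/quotW=> y; rewrite !ab_addE; apply/ab_eqP.
by rewrite invgM -!mulgA commg_commutator_subgroup.
Qed.

Lemma ab_add0 : left_id ab_zero ab_add.
Proof. by elim/quotW=> x; rewrite ab_addE mul1g. Qed.

Lemma ab_addN : left_inverse ab_zero ab_opp ab_add.
Proof. by elim/quotW=> x; rewrite ab_oppE ab_addE mulVg. Qed.

HB.instance Definition _ :=
  GRing.isZmodule.Build Ab ab_addA ab_addC ab_add0 ab_addN.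

Lemma pi_AbM x y : \pi_Ab (x * y) = (\pi_Ab x + \pi_Ab y)%R.
Proof. by rewrite -ab_addE. Qed.

Definition perfect := forall u : Ab, u = 0%R.

End Commutator.

Definition group_prod (I : Type) (H : I -> groupType) := forall i, H i.

Section GroupProd.
Variables (I : Type) (H : I -> groupType).
Local Open Scope group_scope.
Local Notation P := (group_prod H).

HB.instance Definition _ := gen_eqMixin P.
HB.instance Definition _ := gen_choiceMixin P.

Definition prod_one : P := fun=> 1.
Definition prod_inv (x : P) : P := fun i => (x i)^-1.
Definition prod_mul (x y : P) : P := fun i => x i * y i.

Lemma prod_mulA : associative prod_mul.
Proof.
by move=> x y z; apply: functional_extensionality_dep => i; exact: mulgA.
Qed.

Lemma prod_mul1 : left_id prod_one prod_mul.
Proof.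
by move=> x; apply: functional_extensionality_dep => i; exact: mul1g.
Qed.

Lemma prod_mulr1 : right_id prod_one prod_mul.
Proof.
by move=> x; apply: functional_extensionality_dep => i; exact: mulg1.
Qed.

Lemma prod_mulV : left_inverse prod_one prod_inv prod_mul.
Proof.
by move=> x; apply: functional_extensionality_dep => i; exact: mulVg.
Qed.

Lemma prod_mulrV : right_inverse prod_one prod_inv prod_mul.
Proof.
by move=> x; apply: functional_extensionality_dep => i; exact: mulgV.
Qed.

HB.instance Definition _ :=
  isGroup.Build P prod_mulA prod_mul1 prod_mulr1 prod_mulV prod_mulrV.

End GroupProd.

Local Open Scope ring_scope.

Definition direct_summand (B : zmodType) (S : zmodClosed B) :=
  exists T : zmodClosed B,
    (forall b, b \in S -> b \in T -> b = 0) /\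
    (forall b, exists s t, [/\ s \in S, t \in T & b = s + t]).

(* "B contains A as a subgroup" is an isomorphism i of A onto a subgroup S of *)
(* B.                                                                         *)
Definition cotorsion (A : zmodType) :=
  forall (B : zmodType) (S : zmodClosed B) (i : {additive A -> B}),
    injective i -> (forall b, b \in S <-> exists a, i a = b) ->
    (exists q : {additive Quotient.quot S -> rat}, bijective q) ->
    direct_summand S.

(* An ordinal is represented by any well-ordered type of that order type;     *)
(* equality of ordinals is order isomorphism.                                 *)
Record ordnum := Ord {
  ord_sort :> eqType;
  ole : rel ord_sort;
  ole_wo : well_order ole
}.

Definition olt (a : ordnum) (x y : a) := ole x y && (x != y).

Definition ord_iso (a b : ordnum) :=
  exists2 f : a -> b, bijective f & {mono f : x y / ole x y}.

Section OrdTheory.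
Variable a : ordnum.
Implicit Types x y z : a.

Let wo_chain_a : wo_chain (@ole a) predT.
Proof. by move=> X _; exact: ole_wo. Qed.

Lemma olexx x : ole x x.
Proof. exact: (wo_chain_reflexive wo_chain_a). Qed.

Lemma ole_total x y : ole x y || ole y x.
Proof. exact: (wo_chainW wo_chain_a). Qed.

Lemma ole_anti : antisymmetric (@ole a).
Proof. by move=> x y; exact: (wo_chain_antisymmetric wo_chain_a). Qed.

Lemma ole_min (X : a -> Prop) x :
  X x -> exists2 m, X m & forall y, X y -> ole m y.
Proof.
move=> Xx; have [|m [[/asboolP Xm mX] _]] := @ole_wo a (fun y => `[< X y >]).
  by exists x; apply/asboolP.
by exists m => // y Xy; apply: mX; apply/asboolP.
Qed.

Lemma ole_trans y x z : ole x y -> ole y z -> ole x z.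
Proof.
move=> xy yz.
have [|m mX mmin] := @ole_min (fun t => t = x \/ t = y \/ t = z) x.
  by left.
case: mX mmin => [->|[->|->]] mmin; first by apply: mmin; right; right.
  have yx := mmin x (or_introl erefl).
  by have /ole_anti -> : ole x y && ole y x by rewrite xy yx.
have zy := mmin y (or_intror (or_introl erefl)).
by have /ole_anti <- : ole y z && ole z y by rewrite yz zy.
Qed.

Lemma oltNge x y : olt x y = ~~ ole y x.
Proof.
rewrite /olt; case: (eqVneq x y) => [->|xy]; first by rewrite olexx.
rewrite andbT; apply/idP/idP => [le_xy|]; last first.
  by move=> /negbTE yx; have := ole_total x y; rewrite yx orbF.
apply/negP => yx; move/eqP: xy; apply; apply: ole_anti.
by rewrite le_xy yx.
Qed.

Section Sub.
Variables (p : pred a).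
Let sub := {y : a | p y}.
Definition sub_ole : rel sub := fun u v => ole (val u) (val v).

Lemma sub_ole_wo : well_order sub_ole.
Proof.
apply: antisymmetric_well_order => [y z /ole_anti/val_inj//|X [y Xy]].
have [|_ [u [uX <-]] umin] :=
    @ole_min (fun t => exists u, u \in X /\ val u = t) (val y).
  by exists y.
by exists u; split=> // v vX; apply: umin; exists v.
Qed.

Definition sub_ord := Ord sub_ole_wo.
End Sub.

Definition oseg x := sub_ord (fun y => olt y x).

Definition osucc_ole : rel (option a) := fun u v =>
  match u, v with
  | _, None => true
  | None, Some _ => false
  | Some x, Some y => ole x y
  end.

Lemma osucc_ole_wo : well_order osucc_ole.
Proof.
apply: antisymmetric_well_order => [[x|] [y|] //= /ole_anti->//|X [u uX]].
have [[x xX]|noX] := pselect (exists x, Some x \in X).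
  have [m mX mmin] := @ole_min (fun x => Some x \in X) x xX.
  by exists (Some m); split=> // -[y|] //=; exact: mmin.
case: u uX => [x|] uX; first by case: noX; exists x.
by exists None; split=> // -[y|] // yX; case: noX; exists y.
Qed.

Definition osucc := Ord osucc_ole_wo.

End OrdTheory.

Lemma void_wo : well_order (fun _ _ : void => true).
Proof. by move=> X [[]]. Qed.

Definition ozero := Ord void_wo.

Definition ord_lt (a b : ordnum) := exists x : b, ord_iso a (oseg x).

Definition ord_le (a b : ordnum) := ord_lt a b \/ ord_iso a b.

Definition limit_ordinal (a : ordnum) :=
  ~ ord_iso a ozero /\ forall b, ~ ord_iso a (osucc b).

(* Transfinite recursion along ordinals, in the form of an inductive          *)
(* predicate; the recursion equations are ulm0, ulmS and ulm_limit below.     *)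
Inductive ulm (A : zmodType) : ordnum -> A -> Prop :=
| Ulm0 l x : ord_iso l ozero -> ulm l x
| UlmS l m x : ord_iso l (osucc m) ->
    (forall n, (0 < n)%N -> exists y, ulm m y /\ y *+ n = x) -> ulm l x
| UlmLimit d x : limit_ordinal d ->
    (forall l, ord_lt l d -> ulm l x) -> ulm d x.

Arguments ulm : clear implicits.

Lemma ord_iso_refl a : ord_iso a a.
Proof. by exists id => //; exists id. Qed.

Lemma ord_iso_sym a b : ord_iso a b -> ord_iso b a.
Proof.
move=> [f [g fK gK] fmono]; exists g; first by exists f.
by move=> x y; rewrite -{2}[x]gK -{2}[y]gK fmono.
Qed.

Lemma ord_iso_trans b a c : ord_iso a b -> ord_iso b c -> ord_iso a c.
Proof.
move=> [f fbij fmono] [g gbij gmono]; exists (g \o f); first exact: bij_comp.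
by move=> x y; rewrite /= gmono fmono.
Qed.

Lemma ord_lt_isor a b c : ord_lt a b -> ord_iso b c -> ord_lt a c.
Proof.
move=> [x ax] [f [g fK gK] fmono]; exists (f x); apply: (ord_iso_trans ax).
have fP (u : oseg x) : olt (f (val u)) (f x).
  by rewrite oltNge fmono -oltNge; exact: (valP u).
have gP (u : oseg (f x)) : olt (g (val u)) x.
  by rewrite oltNge -fmono gK -oltNge; exact: (valP u).
exists (fun u => Sub (f (val u)) (fP u) : oseg (f x)).
  exists (fun u => Sub (g (val u)) (gP u) : oseg x) => u; apply: val_inj.
    exact: fK.
  exact: gK.
by move=> u v; exact: fmono.
Qed.

Lemma osucc_iso_inj a b : ord_iso (osucc a) (osucc b) -> ord_iso a b.
Proof.
move=> [f [g fK gK] fmono].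
have fN : f None = None.
  have : @ole (osucc b) (f (g None)) (f None) by rewrite fmono; case: (g None).
  by rewrite gK; case: (f None).
have gN : g None = None by rewrite -fN fK.
have fS x : exists y, f (Some x) = Some y.
  case E : (f (Some x)) => [y|]; first by exists y.
  by have := fK (Some x); rewrite E gN.
have gS y : exists x, g (Some y) = Some x.
  case E : (g (Some y)) => [x|]; first by exists x.
  by have := gK (Some y); rewrite E fN.
have [f' f'E] := choice fS; have [g' g'E] := choice gS.
exists f'; last by move=> x y; have := fmono (Some x) (Some y); rewrite !f'E.
exists g' => x; first by have := fK (Some x); rewrite f'E g'E => -[].
by have := gK (Some x); rewrite g'E f'E => -[].
Qed.

Lemma osucc_neq0 a : ~ ord_iso (osucc a) ozero.
Proof. by move=> [f _ _]; case: (f None). Qed.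

Lemma limit_ordinal_iso a b : ord_iso a b -> limit_ordinal a -> limit_ordinal b.
Proof.
by move=> ab [a0 aS]; split=> [b0|c bc]; [apply: a0 | apply: (aS c)];
  exact: ord_iso_trans ab _.
Qed.

Section UlmTheory.
Variable A : zmodType.
Local Open Scope classical_set_scope.

Lemma ulm_iso l m : ord_iso l m -> ulm A l = ulm A m.
Proof.
suff sub a b : ord_iso a b -> ulm A a `<=` ulm A b.
  by move=> lm; apply/seteqP; split; apply: sub => //; exact: ord_iso_sym.
move=> ab x ax; case: a x / ax ab => [a x a0|a c x ac xn|a x alim xa] ab.
- by apply: Ulm0; exact: ord_iso_trans (ord_iso_sym ab) a0.
- by apply: UlmS xn; exact: ord_iso_trans (ord_iso_sym ab) ac.
- apply: UlmLimit; first exact: limit_ordinal_iso ab alim.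
  by move=> c cb; apply: xa; exact: ord_lt_isor cb (ord_iso_sym ab).
Qed.

Lemma ulm0 : ulm A ozero = setT.
Proof. by apply/seteqP; split=> // x _; apply: Ulm0; exact: ord_iso_refl. Qed.

Lemma ulmS l :
  ulm A (osucc l) =
  \bigcap_(n in [set n | (0 < n)%N]) [set x *+ n | x in ulm A l].
Proof.
apply/seteqP; split=> x; last first.
  move=> xn; apply: UlmS (ord_iso_refl _) _ => n /xn[y ly <-].
  by exists y.
move E : (osucc l) => s sx.
case: s x / sx E => [s x s0|s m x sm xn|s x slim _] E.
- by case: (@osucc_neq0 l); rewrite E.
- move=> n /xn[y [my <-]]; exists y => //.
  by rewrite (@ulm_iso _ m) //; apply: osucc_iso_inj; rewrite E.
- by case: slim => _ /(_ l); case; rewrite -E; exact: ord_iso_refl.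
Qed.

Lemma ulm_limit d : limit_ordinal d ->
  ulm A d = [set x | forall l, ord_lt l d -> ulm A l x].
Proof.
move=> dlim; apply/seteqP; split=> x; last by move=> xl; exact: UlmLimit.
move=> dx; case: d x / dx dlim => [s x s0|s m x sm _|s x _ xl] slim //.
- by case: slim.
- by case: slim => _ /(_ m).
Qed.

(* l is the Ulm length of A. *)
Definition is_ulm_length (l : ordnum) :=
  ulm A (osucc l) = ulm A l /\
  forall m, ulm A (osucc m) = ulm A m -> ord_le l m.

End UlmTheory.

Section Aleph1.
Local Open Scope classical_set_scope.

Definition first_uncountable (a : ordnum) :=
  ~ countable [set: a] /\ forall b, ord_lt b a -> countable [set: b].

Lemma inj_countable (T U : Type) (f : T -> U) :
  injective f -> countable [set: U] -> countable [set: T].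
Proof.
move=> finj /countable_injP[g ginj]; apply/countable_injP; exists (g \o f).
by move=> x y _ _ E; apply: finj; apply: ginj => //; rewrite in_setT.
Qed.

Lemma set_nat_uncountable : ~ countable [set: set nat].
Proof.
move=> /countable_injP[f finj].
pose D : set nat := [set n | exists2 X, f X = n & ~ X n].
have notD : ~ D (f D).
  move=> fD; case: (fD) => X /finj E; apply; rewrite E ?in_setT//.
by apply: (notD); exists D.
Qed.

Lemma first_uncountable_exists : exists a, first_uncountable a.
Proof.
have [R Rwo] := well_ordering_principle (set nat : eqType).
pose w := Ord Rwo.
pose p : pred w := fun x => `[< countable [set: oseg x] >].
exists (sub_ord p); split=> [Sc|b [x [f /bij_inj finj _]]].
  have [|/existsNP[x xp]] := pselect (forall x, p x).
    move=> allp; apply: set_nat_uncountable.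
    apply: (@inj_countable _ _ (fun x : w => Sub x (allp x) : sub_ord p)) Sc.
    by move=> u v /(congr1 val).
  have [m mp mmin] := @ole_min w (fun x => ~ p x) x xp.
  have segp (u : oseg m) : p (val u).
    apply: contrapT => /mmin mu.
    by have := valP u; rewrite oltNge mu.
  apply: mp; apply/asboolP.
  apply: (@inj_countable _ _
           (fun u : oseg m => Sub (val u) (segp u) : sub_ord p)) Sc.
  by move=> u v /(congr1 val) E; exact: val_inj.
have /asboolP xc := valP x.
have segx (u : oseg x) : olt (val (val u)) (val x).
  by rewrite oltNge; have := valP u; rewrite oltNge.
apply: (inj_countable finj).
apply: (@inj_countable _ _
         (fun u => Sub (val (val u)) (segx u) : oseg (val x))) xc.
by move=> u v /(congr1 val) E; do 2!apply: val_inj.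
Qed.

Definition aleph1 : ordnum := projT1 (cid first_uncountable_exists).

Lemma aleph1P : first_uncountable aleph1.
Proof. exact: projT2 (cid first_uncountable_exists). Qed.

End Aleph1.

(* Main.v *)
(* An element of a product of groups is a product of k commutators iff all    *)
(* its coordinates are, and, the factors being perfect, finitely many         *)
(* coordinates do not affect the class of an element in the abelianization.   *)
(* Hence systems x_n = a_n + (n + 1) x_(n+1) can be solved coordinatewise by  *)
(* terminating recursions, which kills Ext(Q, -).                             *)
(*   If the class of g lies in the Ulm subgroup of index aleph_1, then for    *)
(* every l < aleph_1 there are g = y_0, ..., y_n with y_j and y_(j+1)^(j+1)   *)
(* differing by a product of k_j commutators and the class of y_n in the      *)
(* l-th Ulm subgroup; by uncountable cofinality the k_j can be chosen         *)
(* uniformly in l, and then successively for all n. Taking the i-th           *)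
(* coordinates from a chain of length i gives an infinite chain, so g lies in *)
(* a divisible subgroup, hence in all Ulm subgroups.                          *)
From HB Require Import structures.
Require Import Defs.
From mathcomp Require Import all_boot all_order all_algebra.
From mathcomp Require Import boolp classical_sets cardinality.

Set Implicit Arguments.
Unset Strict Implicit.
Unset Printing Implicit Defensive.

Import GRing.Theory Num.Theory.

(** Both halves rest on [pi_Ab_group_prod]: an equation holds in the abelianization once, at almost
    all coordinates, it holds up to a bounded number of commutators. Cotorsion is
    [Ab_group_prod_solve] fed into [solve_cotorsion]. For the Ulm length, [ulm_first_uncountable]
    puts the Ulm subgroup of index aleph_1 inside all the others, and [ulm_length_exists] extracts
    the least stable index. *)

(** * Commutator length in products of groups *)

Section CommutatorLength.
Local Open Scope group_scope.

(** Exactly [k] commutators amounts to at most [k], because [[~ 1, 1] = 1]. *)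
Fixpoint comm_prod (G : groupType) (k : nat) (x : G) : Prop :=
  if k is k'.+1 then exists a b y, comm_prod k' y /\ x = [~ a, b] * y
  else x = 1.

Lemma comm_prod_leq (G : groupType) (k l : nat) (x : G) :
  k <= l -> comm_prod k x -> comm_prod l x.
Proof.
move=> /subnKC <- xk; rewrite addnC; elim: (l - k)%N => //= n IH.
by exists 1, 1, x; split=> //; rewrite commgg mul1g.
Qed.

Lemma comm_prodM (G : groupType) (k l : nat) (x y : G) :
  comm_prod k x -> comm_prod l y -> comm_prod (k + l) (x * y).
Proof.
move=> xk yl; elim: k x xk => [_ ->|k IH _ [a [b [z [zk ->]]]]].
  by rewrite mul1g.
by exists a, b, (z * y); split; [exact: IH | rewrite mulgA].
Qed.

Lemma comm_prodV (G : groupType) (k : nat) (x : G) :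
  comm_prod k x -> comm_prod k x^-1.
Proof.
elim: k x => [_ ->|k IH _ [a [b [z [zk ->]]]]]; first by rewrite invg1.
rewrite invgM invgR -addn1; apply: comm_prodM; first exact: IH.
by exists b, a, 1; rewrite mulg1.
Qed.

Lemma commutator_subgroup_comm_prod (G : groupType) (x : G) :
  x \in @commutator_subgroup G <-> exists k, comm_prod k x.
Proof.
split=> [/commutator_subgroupP xC|[k]]; last first.
  have [C1 _] := @commutator_subgroup_closed G.
  elim: k x => [_ -> //|k IH _ [a [b [z [zk ->]]]]].
  apply: (group_closedM (@commutator_subgroup_closed G)); last exact: IH.
  exact: commg_commutator_subgroup.
have xS := xC (fun y => `[< exists k, comm_prod k y >]).
apply/asboolP; apply: xS => [|a b]; last first.
  by apply/asboolP; exists 1%N, a, b, 1; rewrite mulg1.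
split; first by apply/asboolP; exists 0%N.
move=> y z /asboolP[k yk] /asboolP[l zl]; apply/asboolP.
by exists (k + l)%N; apply: comm_prodM => //; exact: comm_prodV.
Qed.

Lemma pi_Ab_eq0 (G : groupType) (x : G) :
  (\pi_(Ab G) x)%qT = 0%R <-> x \in @commutator_subgroup G.
Proof.
rewrite -[0%R]/(\pi_(Ab G) 1)%qT; split=> [/esym/ab_eqP|xC].
  by rewrite invg1 mul1g.
by apply/esym/ab_eqP; rewrite invg1 mul1g.
Qed.

Lemma pi_AbX (G : groupType) (x : G) (n : nat) :
  (\pi_(Ab G) (x ^+ n))%qT = ((\pi_(Ab G) x)%qT *+ n)%R.
Proof.
elim: n => [|n IH].
  by rewrite mulr0n; apply/pi_Ab_eq0; case: (@commutator_subgroup_closed G).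
by rewrite expgS mulrS pi_AbM IH.
Qed.

Section Product.
Variables (I : Type) (H : I -> groupType).
Implicit Types x : group_prod H.

Lemma group_prodM x y i : (x * y) i = x i * y i.
Proof. by []. Qed.

Lemma group_prodX x n i : (x ^+ n) i = x i ^+ n.
Proof. by elim: n => [|n IH] //; rewrite !expgS -IH. Qed.

(** The common bound [k] lets the commutators be chosen coordinate by coordinate. *)
Lemma comm_prod_group_prod k x : (forall i, comm_prod k (x i)) -> comm_prod k x.
Proof.
elim: k x => [x x1|k IH x xk].
  by apply: functional_extensionality_dep.
have abz_ex i : exists abz : H i * H i * H i,
    comm_prod k abz.2 /\ x i = [~ abz.1.1, abz.1.2] * abz.2.
  by have [a [b [z abz]]] := xk i; exists (a, b, z).
pose f i := projT1 (cid (abz_ex i)).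
have fP i : comm_prod k (f i).2 /\ x i = [~ (f i).1.1, (f i).1.2] * (f i).2.
  exact: projT2 (cid (abz_ex i)).
exists (fun i => (f i).1.1), (fun i => (f i).1.2), (fun i => (f i).2).
split; first by apply: IH => i; case: (fP i).
by apply: functional_extensionality_dep => i; case: (fP i).
Qed.

Lemma comm_prod_coord k x i : comm_prod k x -> comm_prod k (x i).
Proof.
elim: k x => [_ -> //|k IH _ [a [b [y [yk ->]]]]].
by exists (a i), (b i), (y i); split; first exact: IH.
Qed.

End Product.

Section PerfectProduct.
Variables (H : nat -> groupType) (H_perfect : forall n, perfect (H n)).
Local Notation G := (group_prod H).
Implicit Types x : G.

Lemma perfect_commutator (K : groupType) (x : K) :
  perfect K -> x \in @commutator_subgroup K.
Proof. by move=> K_perfect; apply/pi_Ab_eq0; exact: K_perfect. Qed.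

(** By perfectness each of the first [N] coordinates has some commutator length; adding these
    finitely many numbers to [k] gives a common bound. *)
Lemma group_prod_commutator N k x :
  (forall i, (N <= i)%N -> comm_prod k (x i)) -> x \in @commutator_subgroup G.
Proof.
move=> xk; apply/commutator_subgroup_comm_prod.
have /choice[c cP] i : exists c, comm_prod c (x i).
  by apply/commutator_subgroup_comm_prod; exact: perfect_commutator.
exists (k + \sum_(j < N) c j)%N; apply: comm_prod_group_prod => i.
have [Ni|iN] := leqP N i.
  by apply: comm_prod_leq (xk i Ni); exact: leq_addr.
apply: comm_prod_leq (cP i); apply: leq_trans (leq_addl _ _).
by rewrite (bigD1 (Ordinal iN)) //= leq_addr.
Qed.

Lemma pi_Ab_group_prod N k x y :
  (forall i, (N <= i)%N -> comm_prod k ((x i)^-1 * y i)) ->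
  (\pi_(Ab G) x = \pi_(Ab G) y)%qT.
Proof.
move=> xy; apply/ab_eqP; exact: (@group_prod_commutator N k (x^-1 * y)).
Qed.

End PerfectProduct.
End CommutatorLength.

(** * Linear systems and cotorsion *)

Local Open Scope ring_scope.

(* [x n = a n + (n + 1) (a (n + 1) + (n + 2) (a (n + 2) + ...))], the infi- *)
(* nite sum making sense coordinatewise once a n is represented by an element *)
(* supported on the coordinates i >= n.                                       *)
Lemma Ab_group_prod_solve (H : nat -> groupType)
    (H_perfect : forall n, perfect (H n)) (a : nat -> Ab (group_prod H)) :
  exists x : nat -> Ab (group_prod H), forall n, x n = a n + x n.+1 *+ n.+1.
Proof.
pose sol i := fix sol d n : H i :=
  if d is d'.+1 then (repr (a n) i * sol d' n.+1 ^+ n.+1)%g else 1%g.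
(* Coordinate [i] unfolds the recursion up to index [i], so the equation for [x n] holds exactly at
   every [i >= n]. *)
pose y n : group_prod H := fun i => sol i (i.+1 - n)%N n.
exists (fun n => \pi_(Ab (group_prod H)) (y n))%qT => n.
rewrite -{1}[a n]reprK -pi_AbX -pi_AbM.
apply: (@pi_Ab_group_prod _ H_perfect n 0%N) => i ni.
rewrite group_prodM group_prodX.
by rewrite /y subSn //= subSS mulVg.
Qed.

Section FactorialChain.
Variables (V : zmodType) (c : nat -> V).
Hypothesis cS : forall n, c n = c n.+1 *+ n.+1.

Lemma factorial_chainE n m : c n = c (n + m)%N *+ ((n + m) ^_ m).
Proof.
elim: m => [|m IH]; first by rewrite addn0 ffactn0.
by rewrite IH cS -mulrnA addnS ffactnS mulnC.
Qed.

Lemma factorial_chain_span n m z w :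
  exists N v, c n *~ z - c m *~ w = c N *~ v.
Proof.
rewrite (factorial_chainE n m) (factorial_chainE m n) (addnC m n).
exists (n + m)%N; eexists.
by rewrite !pmulrn -!mulrzA -mulrzBr.
Qed.

(** An increasing union of cyclic groups: the complement in [solve_cotorsion], the divisible set in
    [factorial_chain_ulm]. *)
Definition factorial_span : pred V := fun b => `[< exists n z, b = c n *~ z >].

Lemma factorial_span_zmod_closed : zmod_closed factorial_span.
Proof.
split; first by apply/asboolP; exists 0%N, 0.
move=> x y /asboolP[n [z ->]] /asboolP[m [w ->]]; apply/asboolP.
exact: factorial_chain_span.
Qed.

End FactorialChain.

Lemma natrM_fact_inv (n : nat) : (n`!%:R^-1 : rat) = n.+1`!%:R^-1 *+ n.+1.
Proof.
rewrite -[RHS]mulr_natl factS natrM invfM mulrA mulfV ?mul1r//.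
by rewrite pnatr_eq0.
Qed.

(** If the denominator is [d + 1], expand the fraction by [d!]. *)
Lemma rat_factorial (r : rat) : exists n (z : int), r = n`!%:R^-1 *~ z.
Proof.
have := denq_gt0 r; case Ed : (denq r) => [[|d]|] // _.
exists d.+1, (numq r * d`!%:Z).
rewrite -[LHS]divq_num_den Ed.
rewrite -[RHS]mulrzl rmorphM factS natrM.
rewrite invfM mulrA -!mulrA (mulrCA _ (d.+1%:R^-1)) mulfV ?mulr1//.
by rewrite pnatr_eq0 -lt0n fact_gt0.
Qed.

(* Q is the direct limit of Z -1-> Z -2-> Z -3-> ..., generated by the 1/n!   *)
(* subject to 1/n! = (n + 1) (1/(n + 1)!); solving the equations corrects     *)
(* arbitrary lifts of the 1/n! to lifts satisfying the same relations.        *)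
Lemma solve_cotorsion (A : zmodType) :
  (forall a : nat -> A, exists x : nat -> A, forall n,
     x n = a n + x n.+1 *+ n.+1) ->
  cotorsion A.
Proof.
move=> Asolve B S i i_inj SE [q [p qK pK]].
pose f (b : B) : rat := q (\pi_(Quotient.quot S) b)%qT.
have fB x y : f (x - y) = f x - f y by rewrite /f !raddfB.
have f0 : f 0 = 0 by rewrite /f !raddf0.
have fS b : (f b = 0) <-> b \in S.
  rewrite -[b in X in _ <-> X]subr0 Quotient.idealrBE -(inj_eq (can_inj qK)).
  by rewrite -/(f b) -/(f 0) f0; split=> /eqP.
have fZ b z : f (b *~ z) = f b *~ z by rewrite /f !raddfMz.
have f_surj r : exists b, f b = r.
  by exists (repr (p r)); rewrite /f reprK pK.
have [b bE] := choice (fun n => f_surj n`!%:R^-1).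
have /choice[a aE] n : exists a, i a = b n - b n.+1 *+ n.+1.
  apply/SE/fS; rewrite fB pmulrn fZ !bE -pmulrn -natrM_fact_inv.
  by rewrite subrr.
have [x xE] := Asolve a.
pose c n := b n - i (x n).
have cS n : c n = c n.+1 *+ n.+1.
  have -> : c n = i (a n) + b n.+1 *+ n.+1 - i (x n) by rewrite aE subrK.
  by rewrite xE raddfD mulrnBl -raddfMn opprD addrACA subrr add0r.
have fc n : f (c n) = n`!%:R^-1.
  by rewrite /c fB bE (_ : f (i _) = 0) ?subr0//; apply/fS/SE; exists (x n).
pose T : zmodClosed B :=
  HB.pack_for (zmodClosed B) (factorial_span c : B -> bool)
    (GRing.isZmodClosed.Build B (factorial_span c)
       (factorial_span_zmod_closed cS)).
(* On the span of the [c n], [f] has trivial kernel, since [z / n! = 0] forces [z = 0], and it is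
   onto by [rat_factorial]. *)
exists T; split=> [d /fS dS /asboolP[n [z dE]]|d].
  move: dS; rewrite dE fZ fc -mulrzl => /eqP; rewrite mulf_eq0 invr_eq0.
  rewrite intr_eq0 pnatr_eq0 => /orP[/eqP->|]; first by rewrite mulr0z.
  by rewrite (gtn_eqF (fact_gt0 n)).
have [n [z dE]] := rat_factorial (f d).
exists (d - c n *~ z), (c n *~ z); split; last by rewrite subrK.
  by apply/fS; rewrite fB fZ fc dE subrr.
by apply/asboolP; exists n, z.
Qed.

(** * Comparison of ordinals *)

Section Ordinals.
Implicit Types a b c l m : ordnum.

Lemma oltW a (x y : a) : olt x y -> ole x y.
Proof. by case/andP. Qed.

Lemma ole_lt_trans a (x y z : a) : ole x y -> olt y z -> olt x z.
Proof. by rewrite !oltNge => xy; apply: contra => /ole_trans; exact. Qed.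

Lemma ole_oltP a (x y : a) : ole x y <-> x = y \/ olt x y.
Proof.
rewrite /olt; split=> [->|[->|/andP[]//]]; last exact: olexx.
by case: eqP => [->|_]; [left | right].
Qed.

Lemma ord_iso_surj a b (f : a -> b) :
  {mono f : x y / ole x y} -> (forall y, exists x, f x = y) -> ord_iso a b.
Proof.
move=> fmono /choice[g gK]; exists f => //; exists g => // x.
by apply: ole_anti; rewrite -!fmono gK olexx.
Qed.

Lemma oseg_lt a (x : a) : ord_lt (oseg x) a.
Proof. by exists x; exact: ord_iso_refl. Qed.

Lemma ord_lt_isol a b c : ord_iso a b -> ord_lt b c -> ord_lt a c.
Proof. by move=> ab [x bx]; exists x; exact: ord_iso_trans ab bx. Qed.

Lemma oseg_oseg a (x : a) (u : oseg x) : ord_iso (oseg u) (oseg (val u)).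
Proof.
have uP (v : oseg u) : olt (val (val v)) (val u).
  by have := valP v; rewrite !oltNge.
pose f (v : oseg u) : oseg (val u) := Sub (val (val v)) (uP v).
apply: (@ord_iso_surj _ _ f); first by [].
move=> v; have vx : olt (val v) x.
  by apply: ole_lt_trans (valP u); apply: oltW; exact: (valP v).
have vu : olt (Sub (val v) vx : oseg x) u.
  by have := valP v; rewrite !oltNge.
by exists (Sub (Sub (val v) vx : oseg x) vu); apply: val_inj.
Qed.

Lemma ord_lt_osegP l a (x : a) :
  ord_lt l (oseg x) <-> exists2 y, olt y x & ord_iso l (oseg y).
Proof.
split=> [[u lu]|[y yx ly]].
  by exists (val u); [exact: valP u | exact: ord_iso_trans lu (oseg_oseg u)].
exists (Sub y yx); apply: ord_iso_trans ly _.
exact: ord_iso_sym (oseg_oseg (Sub y yx : oseg x)).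
Qed.

Lemma oseg_ltS a (x y : a) : olt x y -> ord_lt (oseg x) (oseg y).
Proof.
by move=> xy; apply/ord_lt_osegP; exists x => //; exact: ord_iso_refl.
Qed.

Lemma ord_lt_trans b a c : ord_lt a b -> ord_lt b c -> ord_lt a c.
Proof.
move=> ab [x bx]; have /ord_lt_osegP[y _ ay] := ord_lt_isor ab bx.
by exists y.
Qed.

(** A failure below [l] yields a least [x] in [l] whose segment fails. As [P] may distinguish
    isomorphic ordinals, [Q] speaks of all [m] isomorphic to the segment. *)
Lemma ord_lt_ind (P : ordnum -> Prop) :
  (forall l, (forall m, ord_lt m l -> P m) -> P l) -> forall l, P l.
Proof.
move=> IH l; apply: (IH) => m0 [x0 m0x0].
pose Q (x : l) := ~ forall m, ord_iso m (oseg x) -> P m.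
apply: contrapT => nPm0.
have [|x Qx xmin] := @ole_min l Q x0.
  by move=> Px0; apply: nPm0; exact: Px0.
apply: Qx => m mx; apply: IH => m' m'm.
have /ord_lt_osegP[y yx m'y] := ord_lt_isor m'm mx.
apply: contrapT => nPm'; move: yx; rewrite oltNge => /negP; apply.
by apply: xmin => Py; apply: nPm'; exact: Py.
Qed.

Lemma ord_lt_irr l : ~ ord_lt l l.
Proof. by elim/ord_lt_ind: l => l IH l_lt_l; exact: IH (l_lt_l). Qed.

Lemma oseg_lt_inj a (x y : a) : ord_lt (oseg x) (oseg y) <-> olt x y.
Proof.
split=> [xy|]; last exact: oseg_ltS.
rewrite oltNge; apply/negP => /ole_oltP[yx|/oseg_ltS yx].
  by apply: (@ord_lt_irr (oseg x)); rewrite yx in xy *.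
exact: ord_lt_irr (ord_lt_trans xy yx).
Qed.

(** By induction every segment of [a] is isomorphic to one of [b]. This embeds [a] in [b] with
    downward closed image: all of [b], or the segment below the least missed point. *)
Lemma ord_le_total a b : ~ ord_lt b a -> ord_le a b.
Proof.
elim/ord_lt_ind: a => a IH nba.
have /choice[f fP] (x : a) : exists y : b, ord_iso (oseg x) (oseg y).
  have [|//|xb] := IH _ (oseg_lt x).
    by move=> bx; apply: nba; exact: ord_lt_trans bx (oseg_lt x).
  by case: nba; exact: ord_lt_isol (ord_iso_sym xb) (oseg_lt x).
have fmono : {mono f : x y / ole x y}.
  move=> x y; apply: negb_inj; rewrite -!oltNge; apply/idP/idP => /oseg_lt_inj.
    move=> fyx; apply/oseg_lt_inj; apply: ord_lt_isol (fP y) _.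
    exact: ord_lt_isor fyx (ord_iso_sym (fP x)).
  move=> yx; apply/oseg_lt_inj; apply: ord_lt_isol (ord_iso_sym (fP y)) _.
  exact: ord_lt_isor yx (fP x).
have [fsurj|] := pselect (forall y, exists x, f x = y).
  by right; exact: ord_iso_surj fmono fsurj.
move=> /existsNP[y0 y0f].
have [y yf ymin] := @ole_min b (fun y => ~ exists x, f x = y) y0 y0f.
left; exists y.
have fy x : olt (f x) y.
  rewrite oltNge; apply/negP => /ole_oltP[yE|/oseg_ltS yfx].
    by apply: yf; exists x.
  have /ord_lt_osegP[z _ yz] := ord_lt_isor yfx (ord_iso_sym (fP x)).
  apply: yf; exists z; apply: ole_anti.
  have yfz := ord_iso_trans yz (fP z).
  apply/andP; split; apply: contrapT => /negP; rewrite -oltNge => /oseg_ltS lt.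
    exact: ord_lt_irr (ord_lt_isor lt (ord_iso_sym yfz) ).
  exact: ord_lt_irr (ord_lt_isor lt yfz).
pose g x : oseg y := Sub (f x) (fy x).
apply: (@ord_iso_surj _ _ g).
  by move=> x x'; exact: fmono.
move=> u; have [x fx] : exists x, f x = val u.
  apply: contrapT => /ymin; apply/negP; rewrite -oltNge; exact: (valP u).
by exists x; apply: val_inj.
Qed.

Lemma oseg_osucc_None b : ord_iso b (oseg (None : osucc b)).
Proof.
pose f (x : b) : oseg (None : osucc b) := Sub (Some x : osucc b) isT.
apply: (@ord_iso_surj _ _ f); first by [].
move=> u; have := valP u; case E : (val u) => [x|] //= _.
by exists x; apply: val_inj.
Qed.

Lemma oseg_osucc_Some b (x : b) : ord_iso (oseg x) (oseg (Some x : osucc b)).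
Proof.
have uP (u : oseg x) : olt (Some (val u) : osucc b) (Some x).
  by rewrite oltNge -[ole _ _]/(ole x (val u)) -oltNge; exact: (valP u).
pose f (u : oseg x) : oseg (Some x : osucc b) := Sub (Some (val u)) (uP u).
apply: (@ord_iso_surj _ _ f); first by [].
move=> v; case E : (val v) (valP v) => [y|] vx; last by rewrite oltNge in vx.
have yx : olt y x by move: vx; rewrite !oltNge.
by exists (Sub y yx); apply: val_inj.
Qed.

Lemma ord_lt_osucc b : ord_lt b (osucc b).
Proof. by exists None; exact: oseg_osucc_None. Qed.

Lemma ord_lt_osuccP l b : ord_lt l (osucc b) -> ord_le l b.
Proof.
move=> [[x|] lx].
  left; exists x; apply: ord_iso_trans lx _.
  exact: ord_iso_sym (oseg_osucc_Some x).
by right; apply: ord_iso_trans lx (ord_iso_sym (oseg_osucc_None b)).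
Qed.

Lemma ord_le_lt_irr a b : ord_le a b -> ~ ord_lt b a.
Proof.
move=> [ab ba|ab ba]; first exact: ord_lt_irr (ord_lt_trans ab ba).
exact: ord_lt_irr (ord_lt_isor ba ab).
Qed.

Lemma limit_osucc_lt l d : limit_ordinal d -> ord_lt l d -> ord_lt (osucc l) d.
Proof.
move=> [_ dS] ld; apply: contrapT => /ord_le_total[/ord_lt_osuccP dl|].
  exact: ord_le_lt_irr dl ld.
exact: dS.
Qed.

Lemma limit_ozero_lt d : limit_ordinal d -> ord_lt ozero d.
Proof. by move=> [d0 _]; apply: contrapT => /ord_le_total[[[]]|]. Qed.

Lemma ord_cases l :
  [\/ ord_iso l ozero, exists b, ord_iso l (osucc b) | limit_ordinal l].
Proof.
have [l0|l0] := pselect (ord_iso l ozero); first by constructor 1.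
have [lS|lS] := pselect (exists b, ord_iso l (osucc b)).
  by constructor 2.
by constructor 3; split=> // b lb; apply: lS; exists b.
Qed.

(** * Ulm subgroups *)

Section Ulm.
Variable A : zmodType.

Lemma ulm_antitone l m x : ord_lt l m -> ulm A m x -> ulm A l x.
Proof.
elim/ord_lt_ind: m l => m IH l lm.
case: (ord_cases m) => [m0|[b mb]|mlim]; last by rewrite ulm_limit//; apply.
  by have [[]] := ord_lt_isor lm m0.
(* The term [n = 1] of the intersection gives the inclusion in the previous subgroup. *)
rewrite (ulm_iso A mb) ulmS => /(_ 1%N isT)[y ybx yx].
have {y ybx yx}bx : ulm A b x by rewrite -yx mulr1n.
have [lb|lb] := ord_lt_osuccP (ord_lt_isor lm mb); last first.
  by rewrite (ulm_iso A lb).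
by apply: (IH b) => //; apply: ord_lt_isor (ord_lt_osucc b) (ord_iso_sym mb).
Qed.

Lemma divisible_ulm (D : A -> Prop) :
  (forall x, D x -> forall n, (0 < n)%N -> exists y, D y /\ y *+ n = x) ->
  forall l x, D x -> ulm A l x.
Proof.
move=> Ddiv; elim/ord_lt_ind => l IH x Dx.
case: (ord_cases l) => [l0|[b lb]|llim]; first exact: Ulm0.
  apply: (UlmS lb) => n /(Ddiv x Dx)[y [Dy yx]]; exists y; split=> //.
  by apply: IH Dy; exact: ord_lt_isor (ord_lt_osucc b) (ord_iso_sym lb).
by apply: (UlmLimit llim) => m ml; exact: IH Dx.
Qed.

Lemma factorial_chain_ulm (c : nat -> A) :
  (forall n, c n = c n.+1 *+ n.+1) -> forall l, ulm A l (c 0%N).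
Proof.
move=> cS l.
pose D y : Prop := factorial_span c y.
apply: (@divisible_ulm D); last first.
  by apply/asboolP; exists 0%N, 1; rewrite mulr1z.
move=> _ /asboolP[n [z ->]] m m_gt0.
(* [c n] is [c (n + m)] times [(n + m) ^_ m = 'C(n + m, m) * m!]; [w] is that factor divided by
   [m]. *)
pose w := ('C(n + m, m) * m.-1`!)%N.
exists (c (n + m)%N *~ (w%:Z * z)); split.
  by apply/asboolP; exists (n + m)%N, (w%:Z * z).
rewrite (factorial_chainE cS n m) -bin_ffact -(prednK m_gt0) factS !prednK //.
rewrite !pmulrn -!mulrzA mulrAC -PoszM; congr (_ *~ (Posz _ * z)).
by rewrite /w -mulnA [(m.-1`! * m)%N]mulnC.
Qed.

(** The least stable index is sought among the segments of [d]; if none is stable, it is [d]. *)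
Lemma ulm_length_exists d :
  ulm A (osucc d) = ulm A d -> exists l, is_ulm_length A l /\ ord_le l d.
Proof.
move=> dstab; pose stable (x : d) := ulm A (osucc (oseg x)) = ulm A (oseg x).
have osuccE l m : ord_iso l m -> ulm A (osucc m) = ulm A m ->
    ulm A (osucc l) = ulm A l.
  by move=> /(ulm_iso A) lm; rewrite !ulmS lm.
have [[x0 x0s]|nstable] := pselect (exists x, stable x); last first.
  exists d; split; last by right; exact: ord_iso_refl.
  split=> // m ms; apply: ord_le_total => -[x mx]; apply: nstable; exists x.
  exact: osuccE (ord_iso_sym mx) ms.
have [x xs xmin] := ole_min x0s.
exists (oseg x); split; last by left; exact: oseg_lt.
split=> // m ms; apply: ord_le_total => /ord_lt_osegP[y yx my].
move: yx; rewrite oltNge => /negP; apply; apply: xmin.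
exact: osuccE (ord_iso_sym my) ms.
Qed.

End Ulm.

(** Uncountable cofinality: an unbounded sequence would cover [d] by countably many countable
    segments with their end points. *)
Lemma first_uncountable_bound d (l : nat -> ordnum) : first_uncountable d ->
  (forall k, ord_lt (l k) d) ->
  exists2 m, ord_lt m d & forall k, ord_lt (l k) m.
Proof.
move=> [d_unc d_seg] ld.
have /choice[u lu] k : exists x : d, ord_iso (l k) (oseg x) by exact: ld.
have [[v uv]|nbd] := pselect (exists v, forall k, olt (u k) v).
  exists (oseg v); first exact: oseg_lt.
  by move=> k; apply: ord_lt_isol (lu k) _; exact: oseg_ltS.
case: d_unc.
have /choice[j jP] v : exists k, ole v (u k).
  apply: contrapT => vu; apply: nbd; exists v => k; rewrite oltNge.
  by apply/negP => ?; apply: vu; exists k.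
have /choice[e e_inj] k : exists e : d -> nat,
    forall x y, olt x (u k) -> olt y (u k) -> e x = e y -> x = y.
  have /countable_injP[e e_inj] := d_seg _ (oseg_lt (u k)).
  exists (fun x => if insub x is Some w then e (w : oseg (u k)) else 0%N).
  move=> x y xk yk; rewrite !insubT => /e_inj; rewrite !in_setT => /(_ isT isT).
  by move=> /(congr1 val).
(* [None] encodes the end point [u (j v)], which lies outside its open segment, where [e (j v)] is
   injective. *)
pose f v := (j v, if v == u (j v) then None else Some (e (j v) v)).
apply: (@inj_countable _ _ f); last exact: countableP.
have jlt v : v != u (j v) -> olt v (u (j v)) by rewrite /olt jP => ->.
move=> v w [jvw]; case: (eqVneq v) => [->|/jlt vj].
  by case: (eqVneq w) => // ->; rewrite jvw.
case: (eqVneq w) => // /jlt wj [evw]; apply: (e_inj (j v)) => //.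
  by rewrite jvw.
by rewrite {2}jvw.
Qed.

Lemma first_uncountable_limit d : first_uncountable d -> limit_ordinal d.
Proof.
move=> dunc; split=> [[f /bij_inj f_inj _]|b db].
  by apply: dunc.1; apply: inj_countable f_inj _; exact: countableP.
have bd := ord_lt_isor (ord_lt_osucc b) (ord_iso_sym db).
have [m md /(_ 0%N) bm] := first_uncountable_bound dunc (fun=> bd).
exact: ord_le_lt_irr (ord_lt_osuccP (ord_lt_isor md db)) bm.
Qed.

End Ordinals.

(** * The Ulm subgroup of index aleph_1 of the abelianized product *)

Section UlmProduct.
Variables (H : nat -> groupType) (H_perfect : forall n, perfect (H n)).
Local Notation G := (group_prod H).
Local Notation piG := (fun x : G => \pi_(Ab G) x)%qT.
Variable d : ordnum.
Hypothesis d_unc : first_uncountable d.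
Variable g : G.
Let d_lim := first_uncountable_limit d_unc.

Definition root_chain (ks : seq nat) (y : nat -> G) :=
  y 0%N = g /\ forall j, (j < size ks)%N ->
    comm_prod (nth 0%N ks j) ((y j)^-1 * y j.+1 ^+ j.+1)%g.

(** The lengths are fixed before [l]; the chain may depend on [l]. *)
Definition good_lengths (ks : seq nat) := forall l, ord_lt l d ->
  exists2 y, root_chain ks y & ulm (Ab G) l (piG (y (size ks))).

(* If every k failed at some l k < d, all of them would fail at a common      *)
(* bound of the l k below d.                                                  *)
Lemma good_lengths_rcons ks :
  good_lengths ks -> exists k, good_lengths (rcons ks k).
Proof.
move=> ks_good; apply: contrapT => nk.
have /choice[l lP] k : exists l, ord_lt l d /\
    ~ exists2 y, root_chain (rcons ks k) y &
        ulm (Ab G) l (piG (y (size ks).+1)).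
  apply: contrapT => nl; apply: nk; exists k => m md; rewrite size_rcons.
  by apply: contrapT => nm; apply: nl; exists m.
have [m md lm] := first_uncountable_bound d_unc (fun k => (lP k).1).
(* Level [m + 1] is used so that the end of the chain can be divided once more with quotient at
   level [m]. *)
have [y [y0 y_chain]] := ks_good _ (limit_osucc_lt d_lim md).
rewrite ulmS => /(_ (size ks).+1 isT)[v mv vy].
pose y' j := if (j <= size ks)%N then y j else repr v.
have y'S : y' (size ks).+1 = repr v by rewrite /y' ltnn.
have y'E j : (j <= size ks)%N -> y' j = y j by rewrite /y' => ->.
have /commutator_subgroup_comm_prod[k kP] :
    ((y (size ks))^-1 * repr v ^+ (size ks).+1)%g \in @commutator_subgroup G.
  by apply/ab_eqP; rewrite pi_AbX reprK vy.
case: (lP k) => _; apply; exists y'; last first.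
  by rewrite y'S reprK; exact: ulm_antitone (lm k) mv.
split=> [|j]; first by rewrite y'E.
rewrite size_rcons nth_rcons ltnS leq_eqVlt => /orP[/eqP->|jks].
  by rewrite ltnn eqxx y'E // y'S.
by rewrite jks !y'E ?(ltnW jks) //; exact: y_chain.
Qed.

Lemma ulm_first_uncountable l : ulm (Ab G) d (piG g) -> ulm (Ab G) l (piG g).
Proof.
move=> dg.
have good0 : good_lengths [::].
  move=> m md; exists (fun=> g) => //; exact: ulm_antitone md dg.
have /choice[k kP] ks : exists k, good_lengths ks -> good_lengths (rcons ks k).
  have [/good_lengths_rcons[k kP]|nks] := pselect (good_lengths ks).
    by exists k.
  by exists 0%N.
pose K n := iter n (fun ks => rcons ks (k ks)) [::].
have K_good n : good_lengths (K n) by elim: n => //= n; exact: kP.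
have KE n : K n = mkseq (fun j => k (K j)) n.
  by elim: n => // n IH; rewrite mkseqS -IH.
have /choice[Y YP] n : exists y, root_chain (K n) y.
  by have [y yP _] := K_good n _ (limit_ozero_lt d_lim); exists y.
(* The diagonal: coordinate [i] comes from a chain with [i] links, so link [j] is available for all
   [i > j], with length bound [k (K j)] independent of [i]. *)
pose z j : G := fun i => Y i j i.
have -> : g = z 0%N.
  by apply: functional_extensionality_dep => i; rewrite /z (YP i).1.
apply: (@factorial_chain_ulm _ (fun j => piG (z j))) => j; rewrite -pi_AbX.
apply: (@pi_Ab_group_prod _ H_perfect j.+1 (k (K j))) => i ji.
have := (YP i).2 j; rewrite KE size_mkseq nth_mkseq // => /(_ ji).
move=> /(comm_prod_coord i).
by rewrite group_prodM !group_prodX.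
Qed.

End UlmProduct.

Theorem corollary0p0p8 (H : nat -> groupType)
    (H_perfect : forall n : nat, perfect (H n)) :
  cotorsion (Ab (group_prod H)) /\
  exists l : ordnum, is_ulm_length (Ab (group_prod H)) l /\ ord_le l aleph1.
Proof.
split; first by apply: solve_cotorsion; exact: Ab_group_prod_solve.
apply: ulm_length_exists; apply/seteqP; split=> x.
  exact: ulm_antitone (ord_lt_osucc aleph1).
by rewrite -[x]reprK => /(ulm_first_uncountable H_perfect aleph1P); exact.
Qed.
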